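(* Let $f:\mathbb{D}^n\to\mathbb{D}$ be holomorphic, $\mathcal{C}^2$-smooth on $\overline{\mathbb{D}}^n$, and such that $f(\zeta)=\eta$ for some $\zeta\in\mathbb{T}^n$ and $\eta\in\mathbb{T}$. Then there is a constant $c>0$ such that for all $\delta\in(0,1)$ $$\operatorname{vol}(\{z\in\mathbb{D}^n:\ |f(z)-\eta|\le\delta\})\ge c\,\delta^{(3n+1)/2}.$$
   Context: $\mathbb{D}$ is the open unit disc in $\mathbb{C}$, $\mathbb{T}=\partial\mathbb{D}$, and $\operatorname{vol}$ is ($2n$-dimensional, normalized) Lebesgue volume on $\mathbb{D}^n$. ''$\mathcal{C}^2$-smooth on $\overline{\mathbb{D}}^n$'' means that $f$ extends to a $\mathcal{C}^2$ function on $\overline{\mathbb{D}}^n$; values of $f$ at boundary points are those of the extension. *)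

(* Defs.v *)
From HB Require Import structures.
From mathcomp Require Import all_boot all_order all_algebra.
From mathcomp Require Import complex.
From mathcomp Require Import all_classical all_reals all_analysis.

Set Implicit Arguments.
Unset Strict Implicit.
Unset Printing Implicit Defensive.

Import Order.TTheory GRing.Theory Num.Theory numFieldNormedType.Exports.

Local Open Scope classical_set_scope.
Local Open Scope complex_scope.
Local Open Scope ring_scope.

(* R[i] carries the topology of its modulus and is a normed space over itself;
   hence so is 'rV[R[i]]_n, with the sup norm, and [differentiable] and ['D_v]
   on these spaces are complex differentiability. *)
HB.instance Definition _ (R : realType) :=
  NormedModule.copy R[i] (R[i] : numFieldType)^o.

Section Polydisc.
Context (R : realType) (n : nat).
Notation C := R[i].
Notation Cn := 'rV[R[i]]_n.

Definition polydisc : set Cn := [set z | forall j, `|z 0 j| < 1].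
Definition closed_polydisc : set Cn := [set z | forall j, `|z 0 j| <= 1].
Definition torus : set Cn := [set z | forall j, `|z 0 j| = 1].

Definition holomorphic_on (U : set Cn) (f : Cn -> C) :=
  forall z, U z -> differentiable f z.

(* Real coordinates of C^n: (j, false) is x_j and (j, true) is y_j, where
   z_j = x_j + i y_j. *)
Definition coord_dir (k : 'I_n * bool) : Cn :=
  (if k.2 then 'i%C else 1) *: delta_mx 0 k.1.

(* The increment h is real, so this does not presuppose holomorphy. *)
Definition is_real_partial (k : 'I_n * bool) (F : Cn -> C) (z : Cn) (l : C) :=
  (F (z + (h : R)%:C *: coord_dir k) - F z) / h%:C @[h --> (0 : R)^'] --> l.

(* F is C^2 on the closed polydisc: F is continuous there, its partial
   derivatives of order 1 and 2 with respect to the 2n real coordinates exist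
   in the open polydisc, and they extend continuously to the closed one. F1
   and F2 are these extensions, F2 k l being the one of d_l d_k F. *)
Definition C2_on_closed_polydisc (F : Cn -> C) :=
  {within closed_polydisc, continuous F} /\
  exists (F1 : 'I_n * bool -> Cn -> C)
         (F2 : 'I_n * bool -> 'I_n * bool -> Cn -> C),
    [/\ forall k, {within closed_polydisc, continuous (F1 k)},
        forall k l, {within closed_polydisc, continuous (F2 k l)},
        forall k z, polydisc z -> is_real_partial k F z (F1 k z) &
        forall k l z, polydisc z -> is_real_partial l (F1 k) z (F2 k l z)].

(* F provides the boundary values of f, which is only meaningful on the open
   polydisc. *)
Definition C2_extension (f F : Cn -> C) :=
  (forall z, polydisc z -> F z = f z) /\ C2_on_closed_polydisc F.

End Polydisc.

Section PowerMeasure.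
Context d (T : measurableType d) (R : realType) (mu : set T -> \bar R).

(* The n-fold product mu x ... x mu. *)
Fixpoint power_measure (n : nat) : set (n.-tuple T) -> \bar R :=
  match n with
  | 0 => \d_([tuple] : 0.-tuple T)
  | m.+1 => fun A =>
      (mu \x @power_measure m)%E
        [set p : T * m.-tuple T | A [tuple of p.1 :: p.2]]
  end.

End PowerMeasure.

Definition point_of_coords (R : realType) (n : nat) (t : n.-tuple (R * R)) :
  'rV[R[i]]_n := \row_j Complex (tnth t j).1 (tnth t j).2.

(* 2n-dimensional Lebesgue measure on C^n = (R * R)^n, normalized so that the
   unit polydisc has volume 1. *)
Definition vol (R : realType) (n : nat) (A : set 'rV[R[i]]_n) : \bar R :=
  ((pi ^- n)%:E *
   power_measure (@lebesgue_measure R \x @lebesgue_measure R)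
     [set t : n.-tuple (R * R) | A (point_of_coords t)])%E.

(* Main.v *)
(* Near zeta write z_j = zeta_j (1 - u_j - i v_j). The second order Taylor
   expansion of F at zeta reads
     F z = eta (1 - sum_j alpha_j (u_j + i v_j)) + O(|u|^2 + |v|^2),
   and the alpha_j are real, because otherwise |F| > 1 at some point of the
   polydisc with u_k = t^2 for all k and v_j = t or v_j = - t for a single j,
   t small. Hence |F z - eta| <= delta on the set where u_j ~ delta,
   |v_j| <~ delta^(1/2) and |sum_j alpha_j v_j| <~ delta, which lies in the
   polydisc since v_j^2 < u_j. Its volume is at least of order
   delta^n * delta^(n / 2) * delta^(1 / 2): the v-part is a box of side
   delta^(1/2), cut by a slab of width delta. *)

Require Import Defs.
From mathcomp Require Import all_boot all_order all_algebra.
From mathcomp Require Import complex.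
From mathcomp Require Import all_classical all_reals all_analysis.
From mathcomp Require Import ring lra.

Set Implicit Arguments.
Unset Strict Implicit.
Unset Printing Implicit Defensive.

Import Order.TTheory GRing.Theory Num.Theory numFieldNormedType.Exports.

Local Open Scope classical_set_scope.
Local Open Scope complex_scope.
Local Open Scope ring_scope.

(** The obstacle is that [zeta] lies on the boundary, while the derivatives are given only in the
    open polydisc, as partial derivatives along the axes. The Taylor estimate therefore comes from a
    Lipschitz bound along axis-parallel paths inside the polydisc, used once for the first
    derivatives and once for [F] minus its linear part; the endpoint [zeta] is reached only by
    continuity. The linear part is complex linear because the Cauchy-Riemann equations survive the
    limit. On the measure side, multiplication by zeta_j turns the box in (u_j, v_j) into a tilted
    rectangle of the plane; its area is bounded below by slices, at the price of a factor 1/2. The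
    slab couples the coordinates, and the induction on n carries the contribution of those already
    fixed as an offset [tau]. If all alpha_j vanish, the cut is void and the better exponent 3n/2
    results, which suffices since delta < 1. Throughout, s stands for the square root of delta. *)

Local Notation Re := complex.Re.
Local Notation Im := complex.Im.

(** * Lower bounds for product measures *)

(* [ge0_le_integral] needs both functions to be measurable; this bound does
   not, so no measurability of sections has to be proved. *)
Lemma integral_ge_cst d (T : measurableType d) (R : realType)
    (mu : {measure set T -> \bar R}) (f : T -> \bar R) (B : set T) (c : R) :
  measurable B -> 0 <= c -> (forall x, (0 <= f x)%E) ->
  (forall x, B x -> (c%:E <= f x)%E) ->
  (c%:E * mu B <= \int[mu]_x f x)%E.
Proof.
move=> mB c0 f0 cf; rewrite -integral_cst// integral_mkcond.
rewrite !ge0_integralE//; last first.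
  by move=> x _; apply: erestrict_ge0 => y _ /=; rewrite lee_fin.
apply: le_ereal_sup => _ [h hle <-]; exists h => // x.
apply: le_trans (hle x) _; rewrite !patch_setT /patch.
by case: ifPn => [/set_mem/cf//|_]; exact: f0.
Qed.

(** [m2] is a bare set function so that it can be the tail of [power_measure], which is defined as
    one. *)
Lemma product_measure_ge d1 d2 (T1 : measurableType d1)
    (T2 : measurableType d2) (R : realType) (m1 : {measure set T1 -> \bar R})
    (m2 : set T2 -> \bar R) (A : set (T1 * T2)) (B : set T1) (c : R) :
  measurable B -> 0 <= c -> (forall X, (0 <= m2 X)%E) ->
  (forall x, B x -> (c%:E <= m2 (xsection A x))%E) ->
  (c%:E * m1 B <= (m1 \x m2)%E A)%E.
Proof. by move=> mB c0 m20 H; apply: integral_ge_cst => // x; exact: m20. Qed.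

(** * Areas of rotated rectangles in the plane *)

Section Rect.
Variable R : realType.
Local Notation leb := (@lebesgue_measure R).
Local Notation leb2 := (leb \x leb)%E.

Lemma lebesgue_measure_itv_ge (a b : R) (A : set R) :
  measurable A -> a < b -> (forall x, a < x < b -> A x) ->
  ((b - a)%:E <= leb A)%E.
Proof.
move=> mA ab sub.
rewrite (_ : (b - a)%:E = leb `]a, b[); last first.
  by rewrite lebesgue_measure_itv /= lte_fin ab EFinD.
by apply: le_measure; rewrite ?inE// => x /=; rewrite in_itv/=; exact: sub.
Qed.

(** Tonelli; it allows slicing in the other direction, needed when the rectangle is too steep for
    vertical slices. *)
Lemma lebesgue_measure2_swap (A : set (R * R)) : measurable A ->
  leb2 A = (\int[leb]_y leb (ysection A y))%E.
Proof.
move=> mA.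
have := indic_fubini_tonelli leb leb mA.
rewrite indic_fubini_tonelli_FE// indic_fubini_tonelli_GE//.
Qed.

Lemma lebesgue_measure2_ge_x (A : set (R * R)) (a b l : R) (g : R -> R) :
  measurable A -> a <= b -> 0 < l ->
  (forall x y, a < x < b -> g x < y < g x + l -> A (x, y)) ->
  ((l * (b - a))%:E <= leb2 A)%E.
Proof.
move=> mA ab l0 sub; rewrite EFinM.
move: ab; rewrite le_eqVlt => /predU1P[->|ab].
  by rewrite subrr mule0; exact: measure_ge0.
rewrite (_ : (b - a)%:E = leb `]a, b[); last first.
  by rewrite lebesgue_measure_itv /= lte_fin ab EFinD.
apply: product_measure_ge => //; first exact: ltW.
move=> x /=; rewrite in_itv/= => xab.
rewrite [in leLHS](_ : l = g x + l - g x); last by lra.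
apply: lebesgue_measure_itv_ge; [exact: measurable_xsection|lra|].
by move=> y gy; rewrite /xsection/= inE; exact: sub.
Qed.

Lemma lebesgue_measure2_ge_y (A : set (R * R)) (a b l : R) (g : R -> R) :
  measurable A -> a <= b -> 0 < l ->
  (forall x y, a < y < b -> g y < x < g y + l -> A (x, y)) ->
  ((l * (b - a))%:E <= leb2 A)%E.
Proof.
move=> mA ab l0 sub; rewrite EFinM.
move: ab; rewrite le_eqVlt => /predU1P[->|ab].
  by rewrite subrr mule0; exact: measure_ge0.
rewrite (_ : (b - a)%:E = leb `]a, b[); last first.
  by rewrite lebesgue_measure_itv /= lte_fin ab EFinD.
rewrite lebesgue_measure2_swap//.
apply: integral_ge_cst => //; first exact: ltW.
move=> y /=; rewrite in_itv/= => yab.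
rewrite [in leLHS](_ : l = g y + l - g y); last by lra.
apply: lebesgue_measure_itv_ge; [exact: measurable_ysection|lra|].
by move=> x gx; rewrite /ysection/= inE; exact: sub.
Qed.

(* The points (x, y) with x + i y = (p + i q) (1 - u - i v), a < u < b and
   c < v < d, when p^2 + q^2 = 1. *)
Definition rotated_rect (p q a b c d : R) : set (R * R) :=
  [set z | a < 1 - (p * z.1 + q * z.2) < b /\ c < q * z.1 - p * z.2 < d].

Lemma measurable_rotated_rect p q a b c d :
  measurable (rotated_rect p q a b c d).
Proof.
pose f (z : R * R) := 1 - (p * z.1 + q * z.2).
pose g (z : R * R) := q * z.1 - p * z.2.
rewrite (_ : rotated_rect _ _ _ _ _ _ = f @^-1` `]a, b[ `&` g @^-1` `]c, d[).
  apply: measurableI; rewrite -[X in measurable X]setTI.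
  - apply: (_ : measurable_fun setT f) => //.
    by apply: measurable_realfun.measurable_funB => //;
      apply: measurable_realfun.measurable_funD;
      apply: measurable_realfun.measurable_funM.
  - apply: (_ : measurable_fun setT g) => //.
    by apply: measurable_realfun.measurable_funB => //;
      apply: measurable_realfun.measurable_funM.
by rewrite /rotated_rect; apply/seteqP; split => z /=; rewrite !in_itv.
Qed.

(** The true area is (b - a)(d - c). Half of it is already contained in a parallelogram with two
    sides parallel to an axis, whose slices are intervals of constant length; the aspect ratio
    condition bounds the loss at the two ends. *)
Lemma rotated_rect_ge (p q a b c d : R) :
  p ^+ 2 + q ^+ 2 = 1 -> a < b -> 2 * (b - a) <= d - c ->
  (((b - a) * (d - c) / 2)%:E <= leb2 (rotated_rect p q a b c d))%E.
Proof.
move=> pq ab abcd.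
have mA := measurable_rotated_rect p q a b c d.
pose m := (a + b) / 2; pose h := (b - a) / 2.
pose w := (c + d) / 2; pose k := (d - c) / 2.
have h0 : 0 < h by rewrite /h; lra.
have hk : 2 * h <= k by rewrite /h /k; lra.
(* [r] is the larger of p and q in modulus, so |s| / |r| <= 1. The parallelogram then has area at
   least 4hk - 4h^2, which is at least 2hk because 2h <= k. *)
have area (r s : R) : `|s| <= `|r| -> 0 < `|r| ->
    0 <= `|r| * k - `|s| * h /\
    (b - a) * (d - c) / 2 <= 2 * h / `|r| * (2 * (`|r| * k - `|s| * h)).
  move=> sr r0; split; first by have : 0 <= `|s| by []; nra.
  have sr1 : `|s| / `|r| <= 1 by rewrite ler_pdivrMr// mul1r.
  rewrite (_ : 2 * h / `|r| * (2 * (`|r| * k - `|s| * h)) =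
     4 * h * k - 4 * h ^+ 2 * (`|s| / `|r|)); last by field; lra.
  have -> : (b - a) * (d - c) / 2 = 2 * h * k by rewrite /h/k; field.
  by have := sqr_ge0 h; nra.
have [pleq|qlep] := leP `|p| `|q|.
  have q0 : 0 < `|q|.
    rewrite normr_gt0; apply/eqP => q0; move: pleq pq.
    by rewrite q0 normr0 normr_le0 => /eqP ->; rewrite !expr0n/= addr0; lra.
  have [wd ge] := area q p pleq q0.
  (* The range of x around the centre [x0] is shortened by |p| h: then q (v - w) = (x - x0) + p (u -
     m) is below |q| k in modulus, and the condition on v holds on the whole slice. *)
  set e := `|q| * k - `|p| * h in wd ge.
  pose x0 := q * w + p * (1 - m).
  apply: le_trans (lebesgue_measure2_ge_x (a := x0 - e) (b := x0 + e)
    (l := 2 * h / `|q|) (g := fun x => (1 - m - p * x) / q - h / `|q|) mA _ _ _).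
  - by rewrite lee_fin; apply: le_trans ge _; rewrite le_eqVlt; apply/orP; left;
      apply/eqP; congr (_ * _); ring.
  - by lra.
  - by apply: divr_gt0 => //; lra.
  move=> x y xe ye.
  have qn0 : q != 0 by rewrite -normr_gt0.
  have {}ye : `|p * x + q * y - 1 + m| < h.
    have : `|y - (1 - m - p * x) / q| < h / `|q|.
      by rewrite ltr_norml; apply/andP; split; lra.
    rewrite ltr_pdivlMr// -normrM; congr (`| _ | < _); by field.
  have {}xe : `|x - x0| < e by rewrite ltr_norml; lra.
  have vw : `|q * x - p * y - w| < k.
    rewrite -(ltr_pM2l q0) -normrM.
    have -> : q * (q * x - p * y - w) =
       (x - x0) - p * (p * x + q * y - 1 + m).
      by rewrite /x0 -[X in X - (_ + _)]mul1r -pq; ring.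
    apply: le_lt_trans (ler_normB _ _) _; rewrite normrM.
    by rewrite /e in xe; have : 0 <= `|p| by []; nra.
  move: ye vw; rewrite !ltr_norml /rotated_rect /= /m /h /w /k.
  by split; lra.
have p0 : 0 < `|p| by apply: le_lt_trans qlep.
have [wd ge] := area p q (ltW qlep) p0.
set e := `|p| * k - `|q| * h in wd ge.
pose y0 := q * (1 - m) - p * w.
apply: le_trans (lebesgue_measure2_ge_y (a := y0 - e) (b := y0 + e)
  (l := 2 * h / `|p|) (g := fun y => (1 - m - q * y) / p - h / `|p|) mA _ _ _).
- by rewrite lee_fin; apply: le_trans ge _; rewrite le_eqVlt; apply/orP; left;
    apply/eqP; congr (_ * _); ring.
- by lra.
- by apply: divr_gt0 => //; lra.
move=> x y ye xe.
have pn0 : p != 0 by rewrite -normr_gt0.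
have {}xe : `|p * x + q * y - 1 + m| < h.
  have : `|x - (1 - m - q * y) / p| < h / `|p|.
    by rewrite ltr_norml; apply/andP; split; lra.
  rewrite ltr_pdivlMr// -normrM; congr (`| _ | < _); by field.
have {}ye : `|y - y0| < e by rewrite ltr_norml; lra.
have vw : `|q * x - p * y - w| < k.
  rewrite -(ltr_pM2l p0) -normrM.
  have -> : p * (q * x - p * y - w) =
     q * (p * x + q * y - 1 + m) - (y - y0).
    by rewrite /y0 -[X in _ - (X - _)]mul1r -pq; ring.
  apply: le_lt_trans (ler_normB _ _) _; rewrite normrM.
  by rewrite /e in ye; have : 0 <= `|q| by []; nra.
move: xe vw; rewrite !ltr_norml /rotated_rect /= /m /h /w /k.
by split; lra.
Qed.

End Rect.

(** * Monotonicity of the n-fold product *)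

Section PowerMeasureBounds.
Context d (T : measurableType d) (R : realType).
Variable mu : {measure set T -> \bar R}.

Lemma power_measure_ge0 n (A : set (n.-tuple T)) : (0 <= power_measure mu A)%E.
Proof.
case: n A => [|n] A //=; rewrite /product_measure1.
elim: n A => [|n IH] A; apply: integral_ge0 => x _ //=.
exact: IH.
Qed.

(** Valid for arbitrary sets: the integral of a nonnegative function is a supremum over the simple
    functions below it, so it is monotone whether or not the sections are measurable. *)
Lemma le_power_measure n (A B : set (n.-tuple T)) :
  A `<=` B -> (power_measure mu A <= power_measure mu B)%E.
Proof.
elim: n A B => [|n IH] A B AB.
  rewrite /= !diracE lee_fin ler_nat.
  case: (boolP (_ \in A)) => // /set_mem/AB xB.
  by rewrite mem_set.
rewrite /= /product_measure1 !ge0_integralE; last 2 first.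
- by move=> x _; exact: power_measure_ge0.
- by move=> x _; exact: power_measure_ge0.
apply: le_ereal_sup => _ [h hle <-]; exists h => // x.
apply: le_trans (hle x) _; rewrite !patch_setT; apply: IH => t /=.
by rewrite /xsection/= !inE; exact: AB.
Qed.

End PowerMeasureBounds.

(** * Volume of the slab, by induction on the dimension *)

Section Slab.
Variable R : realType.
Local Notation leb := (@lebesgue_measure R).
Local Notation leb2 := (leb \x leb)%E.

(** Here p_j + i q_j plays the role of zeta_j, and the two expressions bounded for each j are u_j
    and v_j. The offset [tau] is the part of the sum contributed by coordinates fixed earlier in the
    induction. *)
Definition slab n (p q be : 'I_n -> R) (k s tau : R) : set (n.-tuple (R * R)) :=
  [set t | (forall j, k * s ^+ 2 / 2 <
                        1 - (p j * (tnth t j).1 + q j * (tnth t j).2) <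
                      k * s ^+ 2 /\
              `|q j * (tnth t j).1 - p j * (tnth t j).2| < k / 2 * s) /\
           `|tau + \sum_j be j * (q j * (tnth t j).1 - p j * (tnth t j).2)|
             <= s ^+ 2].

(** Fubini in the first coordinate: u_0 fills an interval of length eps s^2 above k s^2 / 2, and v_0
    a window (a, b) left to the caller, who chooses it according to what the remaining sum can
    tolerate. The factor 1/2 is the loss in [rotated_rect_ge]. *)
Lemma slab_step n (p q be : 'I_n.+1 -> R) (k s tau eps a b C : R) :
  (p ord0) ^+ 2 + (q ord0) ^+ 2 = 1 -> 0 < s -> 0 < eps -> eps <= k / 2 ->
  2 * (eps * s ^+ 2) <= b - a -> - (k / 2 * s) <= a -> b <= k / 2 * s ->
  0 <= C ->
  (forall v, a < v < b ->
    (C%:E <= power_measure leb2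
       (slab (p \o lift ord0) (q \o lift ord0) (be \o lift ord0) k s
             (tau + be ord0 * v)))%E) ->
  ((C * (eps * s ^+ 2 * (b - a) / 2))%:E <=
     power_measure leb2 (slab p q be k s tau))%E.
Proof.
move=> pq s0 e0 ek ab ka kb C0 H.
have s2 : 0 < s ^+ 2 by rewrite exprn_gt0.
have es2 : 0 < eps * s ^+ 2 by rewrite mulr_gt0.
pose B := rotated_rect (p ord0) (q ord0) (k * s ^+ 2 / 2)
  (k * s ^+ 2 / 2 + eps * s ^+ 2) a b.
rewrite EFinM; apply: (@le_trans _ _ (C%:E * leb2 B)%E).
  apply: lee_wpmul2l; first by rewrite lee_fin.
  apply: le_trans (rotated_rect_ge pq _ _); [|lra|lra].
  by rewrite lee_fin; set w := eps * _; rewrite (_ : _ + w - _ = w)//; lra.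
apply: product_measure_ge => //.
- exact: measurable_rotated_rect.
- by move=> X; exact: power_measure_ge0.
move=> x [/= uB vB]; apply: le_trans (H _ vB) _.
apply: le_power_measure => t [/= tuv tau_le].
rewrite /xsection/= inE /=; split.
  move=> j; case: (unliftP ord0 j) => [i ->|->]; last first.
    by rewrite tnth0; split; [nra|rewrite ltr_norml; nra].
  rewrite tnthS; exact: tuv.
rewrite big_ord_recl tnth0 addrA.
by under eq_bigr do rewrite tnthS.
Qed.

(** With zero weights the cut reduces to a condition on [tau], so every v_j uses its full range, and
    each coordinate contributes (k / 2) s^2 times k s, halved. *)
Lemma slab_free_ge n (p q be : 'I_n -> R) (k : R) : 0 < k ->
  (forall j, p j ^+ 2 + q j ^+ 2 = 1) -> (forall j, be j = 0) ->
  exists2 c, 0 < c & forall s tau, 0 < s < 1 -> `|tau| <= s ^+ 2 ->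
    ((c * s ^+ (3 * n))%:E <= power_measure leb2 (slab p q be k s tau))%E.
Proof.
move=> k0; elim: n p q be => [|n IH] p q be pq be0.
  exists 1 => // s tau _ tau_le; rewrite muln0 expr0 mulr1 /= diracE mem_set//.
  by split; [case|rewrite big_ord0 addr0].
have [c c0 Hc] := IH (p \o lift ord0) (q \o lift ord0) (be \o lift ord0)
  (fun j => pq _) (fun j => be0 _).
exists (c * (k ^+ 2 / 4)).
  by rewrite mulr_gt0// divr_gt0// exprn_gt0.
move=> s tau s01 tau_le; have /andP[s0 s1] := s01.
apply: le_trans (slab_step (eps := k / 2) (a := - (k / 2 * s)) (b := k / 2 * s)
  (C := c * s ^+ (3 * n)) _ _ _ _ _ _ _ _ _) => //; last 1 first.
- by move=> v _; rewrite be0 mul0r addr0; exact: Hc.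
- rewrite lee_fin mulnS exprD le_eqVlt; apply/orP; left; apply/eqP.
  by move: (s ^+ (3 * n)) => S; field.
- lra.
- by rewrite expr2; have : s * s <= s; nra.
- by rewrite mulr_ge0// ?exprn_ge0//; exact: ltW.
Qed.

(* The last j with be j != 0 is used to make the sum small; the factors e s
   keep the earlier terms so small that this v_j still has |v_j| < k / 2 * s. *)
Lemma slab_ge n (p q be : 'I_n -> R) (k : R) : 0 < k ->
  (forall j, p j ^+ 2 + q j ^+ 2 = 1) -> (exists j, be j != 0) ->
  exists c e : R, [/\ 0 < c, 0 < e & forall s tau, 0 < s < 1 ->
    `|tau| <= e * s ->
    ((c * s ^+ (3 * n + 1))%:E <= power_measure leb2 (slab p q be k s tau))%E].
Proof.
move=> k0; elim: n p q be => [|n IH] p q be pq [j0 bj0]; first by case: j0 bj0.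
have [[j bj]|be0] := pselect (exists j, be (lift ord0 j) != 0).
  have [c [e [c0 e0 Hc]]] := IH (p \o lift ord0) (q \o lift ord0)
    (be \o lift ord0) (fun j => pq _) (ex_intro _ j bj).
  (* |v_0| <= w s makes the new term at most (e / 2) s; the other half of the tolerance e s is left
     for [tau]. *)
  pose w := Num.min (k / 2) (e / 2 / (`|be ord0| + 1)).
  have b1 : 0 < `|be ord0| + 1 by rewrite ltr_wpDl.
  have w0 : 0 < w by rewrite lt_min !divr_gt0.
  have wk : w <= k / 2 by rewrite ge_min lexx.
  have we : w * (`|be ord0| + 1) <= e / 2.
    by rewrite -ler_pdivlMr// ge_min lexx orbT.
  exists (c * w ^+ 2), (e / 2); split; [|by rewrite divr_gt0|].
    by rewrite mulr_gt0// exprn_gt0.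
  move=> s tau s01 tau_le; have /andP[s0 s1] := s01.
  apply: le_trans (slab_step (eps := w) (a := - (w * s)) (b := w * s)
    (C := c * s ^+ (3 * n + 1)) _ _ _ _ _ _ _ _ _) => //.
  - rewrite lee_fin mulnS -addnA exprD le_eqVlt; apply/orP; left; apply/eqP.
    by move: (s ^+ (3 * n + 1)) => S; field.
  - by have : s ^+ 2 <= s; rewrite ?expr2; nra.
  - nra.
  - nra.
  - by rewrite mulr_ge0// ?exprn_ge0//; exact: ltW.
  move=> v vws; apply: Hc => //.
  apply: le_trans (ler_normD _ _) _; rewrite normrM.
  have {}vws : `|v| <= w * s by rewrite ler_norml; lra.
  have : `|be ord0| * `|v| <= e / 2 * s.
    apply: (@le_trans _ _ (`|be ord0| * (w * s))).
      exact: ler_wpM2l.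
    rewrite mulrA; apply: ler_wpM2r; first exact: ltW.
    by rewrite mulrDr mulr1 in we; lra.
  lra.
have {}be0 j : be (lift ord0 j) = 0.
  by apply: contrapT => /eqP bj; apply: be0; exists j.
have b0 : be ord0 != 0.
  by move: bj0; case: (unliftP ord0 j0) => [i ->|-> //]; rewrite be0 eqxx.
have [c c0 Hc] := slab_free_ge (p := p \o lift ord0) (q := q \o lift ord0)
  (be := be \o lift ord0) k0 (fun j => pq _) be0.
have nb0 : 0 < `|be ord0| by rewrite normr_gt0.
(* The window for v_0 is centred at the zero [v0] of tau + be_0 v. One half of the range k s / 2
   accommodates the centre, the other the half-width w s^2; the width of order s^2 instead of s is
   the source of the extra factor s. *)
pose w := Num.min (k / 4) (`|be ord0|^-1).
have w0 : 0 < w by rewrite lt_min invr_gt0 nb0 divr_gt0.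
have wk : w <= k / 4 by rewrite ge_min lexx.
have wb : `|be ord0| * w <= 1.
  by rewrite mulrC -ler_pdivlMr// mul1r ge_min lexx orbT.
exists (c * w ^+ 2), (k / 4 * `|be ord0|); split.
- by rewrite mulr_gt0// exprn_gt0.
- by rewrite mulr_gt0// divr_gt0.
move=> s tau s01 tau_le; have /andP[s0 s1] := s01.
have s2s : s ^+ 2 <= s by rewrite expr2; nra.
pose v0 := - tau / be ord0.
have v0_le : `|v0| <= k / 4 * s.
  rewrite /v0 normrM normrN normfV ler_pdivrMr//; lra.
move: v0_le; rewrite ler_norml => /andP[v0l v0r].
have ws : w * s ^+ 2 <= k / 4 * s.
  by apply: ler_pM => //; [exact: ltW|rewrite exprn_ge0// ltW].
apply: le_trans (slab_step (eps := w) (a := v0 - w * s ^+ 2)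
  (b := v0 + w * s ^+ 2) (C := c * s ^+ (3 * n)) _ _ _ _ _ _ _ _ _) => //.
- rewrite lee_fin mulnS -addnA !exprD le_eqVlt; apply/orP; left; apply/eqP.
  by move: (s ^+ (3 * n)) => S; field.
- lra.
- lra.
- lra.
- lra.
- by rewrite mulr_ge0// ?exprn_ge0//; exact: ltW.
move=> v vws; apply: Hc => //.
have -> : tau + be ord0 * v = be ord0 * (v - v0) by rewrite /v0; field.
have {}vws : `|v - v0| <= w * s ^+ 2 by rewrite ler_norml; lra.
rewrite normrM; apply: le_trans (ler_wpM2l _ vws) _ => //.
rewrite mulrA; apply: ler_piMl => //.
by rewrite exprn_ge0// ltW.
Qed.

End Slab.

(** * The l1 norm on the complex numbers *)

Section ComplexNorm.
Variable R : realType.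
Implicit Types (z w : R[i]) (x y e : R).

(** The modulus on [R[i]] takes its values in [R[i]]; this equivalent norm is real-valued, so
    estimates stay in [R]. It is submultiplicative, and its constants are absorbed in c. *)
Definition cnorm1 z : R := `|Re z| + `|Im z|.
Local Notation N := cnorm1.

Lemma cnorm1_ge0 z : 0 <= N z.
Proof. by rewrite addr_ge0. Qed.

Lemma cnorm1D z w : N (z + w) <= N z + N w.
Proof.
case: z w => [a b] [c d]; rewrite /cnorm1 /= addrACA.
by apply: lerD; exact: ler_normD.
Qed.

Lemma cnorm1N z : N (- z) = N z.
Proof. by case: z => a b; rewrite /cnorm1 /= !normrN. Qed.

Lemma cnorm1B z w : N (z - w) <= N z + N w.
Proof. by rewrite -(cnorm1N w); exact: cnorm1D. Qed.

Lemma cnorm1_sub z w : N (z - w) = N (w - z).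
Proof. by rewrite -cnorm1N opprB. Qed.

Lemma cnorm1M z w : N (z * w) <= N z * N w.
Proof.
case: z w => [a b] [c d]; rewrite /cnorm1 /=.
apply: (@le_trans _ _ (`|a * c| + `|b * d| + (`|a * d| + `|b * c|))).
  by apply: lerD; [exact: ler_normB|exact: ler_normD].
by rewrite !normrM; lra.
Qed.

Lemma cnorm1MR x z : N (x%:C * z) = `|x| * N z.
Proof.
by case: z => a b; rewrite /cnorm1 /= !mul0r subr0 addr0 !normrM mulrDr.
Qed.

Lemma cnorm1_sum (I : finType) (F : I -> R[i]) :
  N (\sum_i F i) <= \sum_i N (F i).
Proof.
elim/big_ind2: _ => [|a b c d ab cd|//]; first by rewrite /cnorm1 /= normr0 addr0.
by apply: le_trans (cnorm1D _ _) _; exact: lerD.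
Qed.

Lemma normc_le_cnorm1 z : `|z| <= (N z)%:C.
Proof.
case: z => a b; rewrite /cnorm1 normc_def lecR /= -[leRHS]ger0_norm; last first.
  by rewrite addr_ge0.
rewrite -sqrtr_sqr ler_wsqrtr// -(real_normK (num_real a)).
rewrite -(real_normK (num_real b)).
by have := mulr_ge0 (normr_ge0 a) (normr_ge0 b); nra.
Qed.

Lemma Re_le_normc z : `|Re z|%:C <= `|z|.
Proof.
case: z => a b; rewrite normc_def lecR /= -sqrtr_sqr ler_wsqrtr//.
by have := sqr_ge0 b; lra.
Qed.

Lemma Im_le_normc z : `|Im z|%:C <= `|z|.
Proof.
case: z => a b; rewrite normc_def lecR /= -sqrtr_sqr ler_wsqrtr//.
by have := sqr_ge0 a; lra.
Qed.

Lemma cnorm1_lt z e : `|z| < e%:C -> N z < 2 * e.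
Proof.
move=> ze; have := le_lt_trans (Re_le_normc z) ze.
have := le_lt_trans (Im_le_normc z) ze.
by rewrite !ltcR /cnorm1; lra.
Qed.

Lemma cnorm1_eq0 z : (forall e, 0 < e -> N z <= e) -> z = 0.
Proof.
case: z => a b H.
have N0 : N (Complex a b) <= 0.
  by apply/ler_addgt0Pr => e /H; rewrite add0r.
move: N0; rewrite /cnorm1 /= => N0.
have a0 := normr_ge0 a; have b0 := normr_ge0 b.
have /eqP : `|a| = 0 by lra.
have /eqP : `|b| = 0 by lra.
by rewrite !normr_eq0 => /eqP -> /eqP ->.
Qed.

Lemma normc_lt1 z : (`|z| < 1) = (Re z ^+ 2 + Im z ^+ 2 < 1).
Proof.
rewrite normc_def -[X in _ < X]/(1%:C) ltcR -[X in _ < X]sqrtr1 ltr_sqrt//.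
Qed.

Lemma normc_eq1 z : `|z| = 1 -> Re z ^+ 2 + Im z ^+ 2 = 1.
Proof.
rewrite normc_def -[X in _ = X]/(1%:C) => /complexI h.
rewrite -[LHS]sqr_sqrtr ?h ?expr1n//.
by rewrite addr_ge0// sqr_ge0.
Qed.

Lemma gt0c_real (e : R[i]) : 0 < e -> exists2 x, 0 < x & e = x%:C.
Proof.
case: e => a b; rewrite ltcE /= => /andP[/eqP b0 a0].
by exists a => //; rewrite b0.
Qed.

Lemma cvgcP (T : Type) (G : set_system T) {FG : Filter G} (g : T -> R[i]) l :
  g @ G --> l <-> forall e, 0 < e -> \forall x \near G, N (g x - l) < e.
Proof.
split=> [/cvgrPdist_lt gl e e0|H].
  have e20 : 0 < (e / 2)%:C :> R[i] by rewrite ltcR divr_gt0.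
  apply: filterS (gl _ e20) => x /cnorm1_lt.
  by rewrite cnorm1_sub; lra.
apply/cvgrPdist_lt => _ /gt0c_real[e e0 ->].
apply: filterS (H _ e0) => x; rewrite cnorm1_sub => h.
by apply: le_lt_trans (normc_le_cnorm1 _) _; rewrite ltcR.
Qed.

End ComplexNorm.

Local Notation N := (@cnorm1 _).

(** * Taylor expansion at a boundary point *)

Section Box.
Variables (R : realType) (n : nat).
Local Notation Cn := 'rV[R[i]]_n.
Implicit Types (z w : Cn) (r : R).

(** Squares rather than discs around each coordinate: a square contains both corners of any two of
    its points, as the axis-parallel paths below require. *)
Definition box (zeta : Cn) r : set Cn :=
  [set z | forall j, `|Re (z 0 j - zeta 0 j)| <= r /\
                     `|Im (z 0 j - zeta 0 j)| <= r].

Lemma boxW zeta r s : r <= s -> box zeta r `<=` box zeta s.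
Proof. by move=> rs z zb j; have [] := zb j; lra. Qed.

Lemma box_N zeta r z j : box zeta r z -> N (z 0 j - zeta 0 j) <= 2 * r.
Proof. by move=> /(_ j); rewrite /cnorm1; lra. Qed.

Lemma near_box (zeta : Cn) (P : set Cn) :
  (\forall z \near zeta, P z) -> exists2 r : R, 0 < r & box zeta r `<=` P.
Proof.
move=> /nbhs_ballP[_ /gt0c_real[e e0 ->] eP].
exists (e / 3); first by rewrite divr_gt0.
move=> z zb; apply: eP; split=> [|i j]; first by rewrite ltcR.
rewrite (ord1 i) /ball /=.
rewrite -normrN opprB; apply: le_lt_trans (normc_le_cnorm1 _) _.
by rewrite ltcR; have := box_N j zb; lra.
Qed.

Lemma near_polydisc (z : Cn) : polydisc z -> \forall w \near z, polydisc w.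
Proof.
move=> zp.
apply: (@filter_forall Cn 'I_n (fun j => [set w : Cn | `|w 0 j| < 1]) (nbhs z)).
move=> j.
have cj : (fun w : Cn => w 0 j) @ z --> z 0 j.
  exact: (@coord_continuous R[i] 1 n 0 j z).
by have /(_ _ _ (zp j)) := @cvgr_norm_lt _ _ _ _ _ _ _ cj.
Qed.

Lemma torus_closed (zeta : Cn) : torus zeta -> closed_polydisc zeta.
Proof. by move=> zT j; rewrite zT. Qed.

Lemma polydisc_closed (z : Cn) : polydisc z -> closed_polydisc z.
Proof. by move=> zT j; exact: ltW. Qed.

Lemma within_box (H : Cn -> R[i]) (zeta : Cn) (e : R) :
  {within @closed_polydisc R n, continuous H} -> closed_polydisc zeta ->
  0 < e -> exists2 r : R, 0 < r & forall z, polydisc z -> box zeta r z ->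
    N (H z - H zeta) < e.
Proof.
move=> Hc zc e0.
have := Hc zeta; rewrite /continuous_at /prop_for /=.
move=> /cvgcP /(_ _ e0) Hn.
have : within (@closed_polydisc R n) (nbhs (zeta : Cn))
    [set x : Cn | N (H x - H zeta) < e] by rewrite nbhs_subspace_in.
rewrite /within /= => /near_box[r r0 rP]; exists r => // z zp zb.
by apply: rP => //; exact: polydisc_closed.
Qed.

(** The radial points (1 - t) zeta are interior and tend to [zeta]; identities and estimates on the
    open polydisc reach [zeta] through them. *)
Lemma box_polydisc_ex (zeta : Cn) (r : R) : torus zeta -> 0 < r ->
  exists2 w, polydisc w & box zeta r w.
Proof.
move=> zT r0; pose t := Num.min r (1 / 2).
have t0 : 0 < t by rewrite lt_min r0 divr_gt0.
have tr : t <= r by rewrite ge_min lexx.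
have t1 : t <= 1 / 2 by rewrite ge_min lexx orbT.
exists ((1 - t)%:C *: zeta) => j; rewrite !mxE.
  rewrite normrM zT mulr1 normc_def /= expr0n addr0 sqrtr_sqr.
  by rewrite -[X in _ < X]/(1%:C) ltcR ger0_norm; lra.
have := normc_eq1 (zT j); case: (zeta 0 j) => a b /= ab.
have a1 : a ^+ 2 <= 1 by have := sqr_ge0 b; lra.
have b1 : b ^+ 2 <= 1 by have := sqr_ge0 a; lra.
by rewrite !ler_norml; split; nra.
Qed.

End Box.

(** * Real partial derivatives of a holomorphic function *)

Section PartialDerivatives.
Variables (R : realType) (n : nat).
Local Notation Cn := 'rV[R[i]]_n.

Lemma is_real_partialP (k : 'I_n * bool) (F : Cn -> R[i]) (z : Cn) (l : R[i]) :
  is_real_partial k F z l <-> forall e : R, 0 < e ->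
    \forall h \near (0:R)^',
      N ((F (z + h%:C *: coord_dir R k) - F z) / h%:C - l) < e.
Proof. exact: cvgcP. Qed.

Lemma is_real_partial_unique (k : 'I_n * bool) (F : Cn -> R[i]) (z : Cn)
    (l1 l2 : R[i]) :
  is_real_partial k F z l1 -> is_real_partial k F z l2 -> l1 = l2.
Proof. by move=> h1 h2; apply: cvg_unique h1 h2; exact: norm_hausdorff. Qed.

(** For c = 1 or c = i, the real quotient in direction c e_j is c times the complex quotient with
    increment h c, and h c tends to 0 through nonzero values. *)
Lemma holomorphic_partial (f F : Cn -> R[i]) (z : Cn) (j : 'I_n) (b : bool) :
  differentiable f z -> polydisc z -> (forall w, polydisc w -> F w = f w) ->
  is_real_partial (j, b) F z ((if b then 'i%C else 1) * 'D_(delta_mx 0 j) f z).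
Proof.
move=> df zp Ff.
have /(_ (delta_mx 0 j)) := diff_derivable df.
set v : Cn := delta_mx 0 j; set c : R[i] := if b then _ else _.
have c0 : c != 0 by rewrite /c; case: (b); rewrite eq_complex/= oner_eq0 ?andbF.
have Nc : N c = 1 by rewrite /c; case: (b); rewrite /cnorm1 /= normr0 normr1; lra.
move=> dfv.
have {dfv} : h^-1 *: (f (h *: v + z) - f z) @[h --> 0^'] --> 'D_v f z by [].
move=> /cvgcP H; apply/is_real_partialP => e e0.
have hc : (fun h : R => h%:C * c) @ (0 : R) --> (0 : R[i]).
  apply/cvgcP => d d0; near=> h.
  rewrite subr0 cnorm1MR Nc mulr1.
  by near: h; exact: (@pseudometric_normed_Zmodule.nbhs0_lt R R).
have hc0 : (fun h : R => h%:C * c) @ 0^' --> (0 : R[i])^'.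
  move=> P /hc P0; rewrite /fmap /= /dnbhs /within /=.
  have {}P0 : \forall h \near (0 : R), h%:C * c != 0 -> P (h%:C * c) by exact: P0.
  suff : \forall h \near (0 : R), h != 0 -> P (h%:C * c) by [].
  near=> h => h0.
  have : h%:C * c != 0 -> P (h%:C * c) by near: h.
  apply; apply: mulf_neq0 => //.
  by apply: contra_neq h0 => h0; exact: complexI.
have zc : (fun h : R => z + (h%:C * c) *: v) @ 0^' --> z.
  rewrite -[X in _ --> X]addr0 -(scale0r v).
  apply: cvgD; first exact: cvg_cst.
  by apply: cvgZ; last exact: cvg_cst; apply: cvg_trans hc;
    apply: cvg_app; exact: cvg_within.
near=> h.
have h0 : h != 0 by near: h; exact: nbhs_dnbhs_neq.
rewrite /coord_dir scalerA /= -/c -/v.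
rewrite Ff; last by near: h; exact: (zc _ (near_polydisc zp)).
rewrite Ff//.
have : N ((h%:C * c)^-1 *: (f ((h%:C * c) *: v + z) - f z) - 'D_v f z) < e.
  by near: h; exact: (hc0 _ (H _ e0)).
rewrite [_ *: v + z]addrC; apply: le_lt_trans.
rewrite -[leRHS]mul1r -Nc; apply: le_trans (cnorm1M _ _).
rewrite le_eqVlt; apply/orP; left; apply/eqP; congr (N _).
rewrite mulrBr; congr (_ - _).
have hn0 : h%:C != 0 :> R[i] by apply: contra_neq h0 => h0; exact: complexI.
rewrite /GRing.scale /= [RHS]mulrA invfM [_^-1 / c]mulrC mulVKf// mulrC.
by [].
Unshelve. all: by end_near. Qed.

End PartialDerivatives.

(** * Mean value inequality for complex-valued functions of a real variable *)

Section MeanValue.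
Variable R : realType.
Implicit Types (phi dphi : R -> R[i]) (a b B : R).

(* [L] stands for the real or the imaginary part. *)
Lemma is_derive_part (L : R[i] -> R) phi (s : R) (l : R[i]) :
  (forall x y, L (x - y) = L x - L y) ->
  (forall x (h : R), L (x / h%:C) = L x / h) ->
  (forall x, `|L x| <= N x) ->
  (phi (s + h) - phi s) / h%:C @[h --> (0 : R)^'] --> l ->
  is_derive s (1 : R) (L \o phi) (L l).
Proof.
move=> LB LM LN /cvgcP H.
have D : h^-1 *: ((L \o phi) (h *: 1 + s) - (L \o phi) s) @[h --> (0:R)^'] --> L l.
  apply/cvgrPdist_lt => e e0.
  apply: filterS (H _ e0) => h; apply: le_lt_trans.
  rewrite distrC; apply: le_trans (LN _).
  rewrite le_eqVlt; apply/orP; left; apply/eqP; congr (`|_|).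
  rewrite LB LM LB /= /GRing.scale /= mulr1 [h + s]addrC.
  by rewrite [_^-1 * _]mulrC.
apply: DeriveDef; first by apply/cvg_ex; exists (L l).
exact: cvg_lim D.
Qed.

Lemma mean_value_part (L : R[i] -> R) phi dphi a b B :
  (forall x y, L (x - y) = L x - L y) ->
  (forall x (h : R), L (x / h%:C) = L x / h) ->
  (forall x, `|L x| <= N x) -> a < b ->
  (forall s, a <= s <= b ->
     (phi (s + h) - phi s) / h%:C @[h --> (0 : R)^'] --> dphi s) ->
  (forall s, a <= s <= b -> N (dphi s) <= B) ->
  `|L (phi b - phi a)| <= B * (b - a).
Proof.
move=> LB LM LN ab dphiP dphiB.
have D s : a <= s <= b -> is_derive s (1 : R) (L \o phi) (L (dphi s)).
  by move=> sab; apply: is_derive_part => //; exact: dphiP.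
have [||c] := @MVT R (L \o phi) (L \o dphi) a b ab.
- by move=> s; rewrite in_itv /= => /andP[as_ sb]; apply: D; rewrite !ltW.
- apply: derivable_within_continuous => s; rewrite in_itv /= => sab.
  by have [] := D s sab.
rewrite in_itv/= => /andP[ac cb]; rewrite LB /= => ->.
rewrite normrM [`|b - a|]ger0_norm; last by lra.
apply: ler_wpM2r; first by lra.
by apply: le_trans (LN _) _; apply: dphiB; rewrite !ltW.
Qed.

(** The mean value theorem is applied to real and imaginary parts separately, at different
    intermediate points; hence the factor 2. *)
Lemma mean_value_cnorm1 phi dphi a b B : a <= b ->
  (forall s, a <= s <= b ->
     (phi (s + h) - phi s) / h%:C @[h --> (0 : R)^'] --> dphi s) ->
  (forall s, a <= s <= b -> N (dphi s) <= B) ->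
  N (phi b - phi a) <= 2 * B * (b - a).
Proof.
rewrite le_eqVlt => /predU1P[->|ab] H1 H2.
  by rewrite !subrr mulr0 /cnorm1 /= normr0 addr0.
rewrite -mulrA mulr_natl mulr2n; apply: lerD.
- apply: (@mean_value_part _ phi dphi) => //.
  + by move=> [? ?] [? ?].
  + by move=> [x y] h; rewrite -fmorphV /= mulr0 subr0.
  + by move=> [x y]; rewrite /cnorm1 /= lerDl.
- apply: (@mean_value_part _ phi dphi) => //.
  + by move=> [? ?] [? ?].
  + by move=> [x y] h; rewrite -fmorphV /= mulr0 add0r.
  + by move=> [x y]; rewrite /cnorm1 /= lerDr.
Qed.

End MeanValue.

(** * Lipschitz bound along axis-parallel paths *)

Section PathLemma.
Variables (R : realType) (n : nat).
Local Notation Cn := 'rV[R[i]]_n.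
Variables (zeta : Cn) (r : R).
Implicit Types (z w : Cn) (c : R[i]) (j : 'I_n).

Definition boxed_disc j : set R[i] :=
  [set c | [/\ Re c ^+ 2 + Im c ^+ 2 < 1, `|Re (c - zeta 0 j)| <= r &
            `|Im (c - zeta 0 j)| <= r]].

Lemma polydisc_boxE z :
  (polydisc z /\ box zeta r z) <-> forall j, boxed_disc j (z 0 j).
Proof.
split=> [[zp zb] j|H].
  by have [? ?] := zb j; split=> //; rewrite -normc_lt1; exact: zp.
by split=> j; have [? ? ?] := H j; rewrite ?normc_lt1.
Qed.

Lemma boxed_disc_horizontal j (x x' y s : R) :
  boxed_disc j (Complex x y) -> boxed_disc j (Complex x' y) -> x <= s <= x' ->
  boxed_disc j (Complex s y).
Proof.
rewrite /boxed_disc; case: (zeta 0 j) => a b /= [h1 h2 h3] [h4 h5 h6].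
move=> /andP[xs sx].
split=> //=.
  have : s ^+ 2 <= x ^+ 2 \/ s ^+ 2 <= x' ^+ 2; last by lra.
  have [s0|s0] := leP 0 s; [right|left]; rewrite !expr2; nra.
by move: h2 h5; rewrite !ler_norml; lra.
Qed.

Lemma boxed_disc_vertical j (x y y' s : R) :
  boxed_disc j (Complex x y) -> boxed_disc j (Complex x y') -> y <= s <= y' ->
  boxed_disc j (Complex x s).
Proof.
rewrite /boxed_disc; case: (zeta 0 j) => a b /= [h1 h2 h3] [h4 h5 h6].
move=> /andP[xs sx].
split=> //=.
  have : s ^+ 2 <= y ^+ 2 \/ s ^+ 2 <= y' ^+ 2; last by lra.
  have [s0|s0] := leP 0 s; [right|left]; rewrite !expr2; nra.
by move: h3 h6; rewrite !ler_norml; lra.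
Qed.

(** The corner whose abscissa has the smaller modulus stays in the disc; the square contains both
    corners. *)
Lemma boxed_disc_corner j (x y x' y' : R) :
  boxed_disc j (Complex x y) -> boxed_disc j (Complex x' y') ->
  boxed_disc j (Complex x' y) \/ boxed_disc j (Complex x y').
Proof.
rewrite /boxed_disc; case: (zeta 0 j) => a b /= [h1 h2 h3] [h4 h5 h6].
have [xx|xx] := leP (x' ^+ 2) (x ^+ 2); [left|right]; split => //; lra.
Qed.

Definition upd z j c : Cn := \row_i (if i == j then c else z 0 i).

Lemma upd_id z j : upd z j (z 0 j) = z.
Proof. by apply/rowP => i; rewrite mxE; case: eqP => // ->. Qed.

Lemma boxed_disc_upd z j c : (forall i, i != j -> boxed_disc i (z 0 i)) ->
  boxed_disc j c -> forall i, boxed_disc i (upd z j c 0 i).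
Proof. by move=> zV cV i; rewrite mxE; case: eqVneq => [->|/zV]. Qed.

Lemma upd_coord_dir z j c (b : bool) (h : R) :
  upd z j c + h%:C *: coord_dir R (j, b) =
  upd z j (c + h%:C * (if b then 'i%C else 1)).
Proof.
apply/rowP => i; rewrite !mxE /=.
by case: eqP => _; rewrite ?mulr1 // !mulr0 addr0.
Qed.

Variables (G : Cn -> R[i]) (G1 : 'I_n * bool -> Cn -> R[i]) (B : R).
Hypothesis G1P : forall k z, polydisc z -> is_real_partial k G z (G1 k z).
Hypothesis G1B : forall k z, polydisc z -> box zeta r z -> N (G1 k z) <= B.

Lemma move_horizontal_le z j (x x' y : R) :
  (forall i, i != j -> boxed_disc i (z 0 i)) ->
  boxed_disc j (Complex x y) -> boxed_disc j (Complex x' y) -> x <= x' ->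
  N (G (upd z j (Complex x' y)) - G (upd z j (Complex x y))) <=
    2 * B * (x' - x).
Proof.
move=> zV xV x'V xx'.
apply: (@mean_value_cnorm1 _ (fun s => G (upd z j (Complex s y)))
  (fun s => G1 (j, false) (upd z j (Complex s y)))) => // s sx.
  have /polydisc_boxE[sp _] := boxed_disc_upd zV (boxed_disc_horizontal xV x'V sx).
  have := @G1P (j, false) _ sp; rewrite /is_real_partial.
  under eq_fun do rewrite upd_coord_dir mulr1.
  rewrite (_ : (fun h : R => _) = (fun h : R =>
    (G (upd z j (Complex (s + h) y)) - G (upd z j (Complex s y))) / h%:C)) //.
  apply/funext => h; rewrite (_ : Complex s y + h%:C = Complex (s + h) y)//.
  by apply/eqP; rewrite eq_complex/= addr0 !eqxx.
have /polydisc_boxE[sp sb] := boxed_disc_upd zV (boxed_disc_horizontal xV x'V sx).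
exact: G1B.
Qed.

Lemma move_vertical_le z j (x y y' : R) :
  (forall i, i != j -> boxed_disc i (z 0 i)) ->
  boxed_disc j (Complex x y) -> boxed_disc j (Complex x y') -> y <= y' ->
  N (G (upd z j (Complex x y')) - G (upd z j (Complex x y))) <=
    2 * B * (y' - y).
Proof.
move=> zV xV x'V xx'.
apply: (@mean_value_cnorm1 _ (fun s => G (upd z j (Complex x s)))
  (fun s => G1 (j, true) (upd z j (Complex x s)))) => // s sx.
  have /polydisc_boxE[sp _] := boxed_disc_upd zV (boxed_disc_vertical xV x'V sx).
  have := @G1P (j, true) _ sp; rewrite /is_real_partial.
  under eq_fun do rewrite upd_coord_dir.
  rewrite (_ : (fun h : R => _) = (fun h : R =>
    (G (upd z j (Complex x (s + h))) - G (upd z j (Complex x s))) / h%:C)) //.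
  apply/funext => h.
  rewrite (_ : Complex x s + h%:C * 'i%C = Complex x (s + h))//.
  by apply/eqP; rewrite eq_complex/= !mulr0 mul0r mulr1 subr0 !addr0 !eqxx.
have /polydisc_boxE[sp sb] := boxed_disc_upd zV (boxed_disc_vertical xV x'V sx).
exact: G1B.
Qed.

Lemma move_horizontal z j (x x' y : R) :
  (forall i, i != j -> boxed_disc i (z 0 i)) ->
  boxed_disc j (Complex x y) -> boxed_disc j (Complex x' y) ->
  N (G (upd z j (Complex x' y)) - G (upd z j (Complex x y))) <=
    2 * B * `|x' - x|.
Proof.
move=> zV xV x'V; have [xx'|xx'] := leP x x'.
  by rewrite ger0_norm ?subr_ge0//; exact: move_horizontal_le.
rewrite cnorm1_sub ltr0_norm ?subr_lt0// opprB.
by apply: move_horizontal_le => //; exact: ltW.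
Qed.

Lemma move_vertical z j (x y y' : R) :
  (forall i, i != j -> boxed_disc i (z 0 i)) ->
  boxed_disc j (Complex x y) -> boxed_disc j (Complex x y') ->
  N (G (upd z j (Complex x y')) - G (upd z j (Complex x y))) <=
    2 * B * `|y' - y|.
Proof.
move=> zV xV x'V; have [xx'|xx'] := leP y y'.
  by rewrite ger0_norm ?subr_ge0//; exact: move_vertical_le.
rewrite cnorm1_sub ltr0_norm ?subr_lt0// opprB.
by apply: move_vertical_le => //; exact: ltW.
Qed.

Lemma move_coord z j c c' :
  (forall i, i != j -> boxed_disc i (z 0 i)) ->
  boxed_disc j c -> boxed_disc j c' ->
  N (G (upd z j c') - G (upd z j c)) <= 2 * B * N (c' - c).
Proof.
case: c c' => [x y] [x' y'] zV cV c'V; rewrite {2}/cnorm1 /= mulrDr.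
have [dV|dV] := boxed_disc_corner cV c'V.
  have := move_horizontal zV cV dV; have := move_vertical zV dV c'V.
  move=> h1 h2; rewrite -(subrKA (G (upd z j (Complex x' y)))) addrC.
  by apply: le_trans (cnorm1D _ _) _; rewrite addrC [leRHS]addrC; apply: lerD.
have := move_vertical zV cV dV; have := move_horizontal zV dV c'V.
move=> h1 h2; rewrite -(subrKA (G (upd z j (Complex x y')))).
by apply: le_trans (cnorm1D _ _) _; apply: lerD.
Qed.

(** The domain is a product of planar sets, so every hybrid of [z] and [w] lies in it, and the
    coordinates can be exchanged one at a time. *)
Lemma polydisc_box_lipschitz z w (rho : R) : 0 <= B ->
  polydisc z -> box zeta r z -> polydisc w -> box zeta r w ->
  (forall j, N (w 0 j - z 0 j) <= rho) ->
  N (G w - G z) <= n%:R * (2 * B * rho).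
Proof.
move=> B0 zp zb wp wb zw.
have zV := (polydisc_boxE z).1 (conj zp zb).
have wV := (polydisc_boxE w).1 (conj wp wb).
pose hyb m : Cn := \row_i (if (i < m)%N then w 0 i else z 0 i).
have hybV m i : boxed_disc i (hyb m 0 i) by rewrite mxE; case: ifP.
have H m : (m <= n)%N -> N (G (hyb m) - G z) <= m%:R * (2 * B * rho).
  elim: m => [|m IH] mn.
    rewrite (_ : hyb 0%N = z); last by apply/rowP => i; rewrite mxE.
    by rewrite subrr /cnorm1 /= normr0 mul0r addr0.
  pose j := Ordinal mn.
  have -> : hyb m.+1 = upd (hyb m) j (w 0 j).
    apply/rowP => i; rewrite !mxE ltnS leq_eqVlt -(inj_eq val_inj) /=.
    by case: (eqVneq (i : nat) m) => [im|//]; congr (w 0 _); exact: val_inj.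
  rewrite -(subrKA (G (hyb m))); apply: le_trans (cnorm1D _ _) _.
  rewrite -natr1 mulrDl mul1r addrC; apply: lerD; first exact: IH (ltnW mn).
  rewrite -{2}(upd_id (hyb m) j).
  apply: le_trans (move_coord _ _ _) _ => //.
  apply: ler_wpM2l; first by rewrite mulr_ge0.
  by rewrite mxE /= ltnn.
have := H n (leqnn n); rewrite (_ : hyb n = w)//.
by apply/rowP => i; rewrite mxE ltn_ord.
Qed.

End PathLemma.

Lemma common_radius (R : realType) (I : finType) (P : I -> R -> Prop) :
  (forall i r s, s <= r -> P i r -> P i s) ->
  (forall i, exists2 r, 0 < r & P i r) ->
  exists2 r, 0 < r & forall i, P i r.
Proof.
move=> Panti Pex.
suff [r r0 Pr] : exists2 r : R, 0 < r & forall i, i \in enum I -> P i r.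
  by exists r => // i; apply: Pr; rewrite mem_enum.
elim: (enum I) => [|i s [r r0 Pr]]; first by exists 1.
have [r' r'0 Pr'] := Pex i.
exists (Num.min r r'); first by rewrite lt_min r0 r'0.
move=> j; rewrite inE => /predU1P[->|/Pr].
  by apply: Panti Pr'; rewrite ge_min lexx orbT.
by apply: Panti; rewrite ge_min lexx.
Qed.

Section Taylor.
Variables (R : realType) (n : nat).
Local Notation Cn := 'rV[R[i]]_n.
Variable zeta : Cn.
Hypothesis zetaT : torus zeta.

Definition continuous_from_polydisc (G : Cn -> R[i]) := forall e : R, 0 < e ->
  exists2 r : R, 0 < r & forall z, polydisc z -> box zeta r z ->
    N (G z - G zeta) < e.

(** [zeta] is replaced by an interior point w so close that G changes by less than e; the path runs
    from w to z. Both lie in the box, so their coordinates differ by at most 2 rho + 2 rho. *)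
Lemma lipschitz_at (G : Cn -> R[i]) (G1 : 'I_n * bool -> Cn -> R[i])
    (B rho : R) (z : Cn) : 0 <= B -> 0 < rho -> continuous_from_polydisc G ->
  (forall k z, polydisc z -> is_real_partial k G z (G1 k z)) ->
  (forall k z, polydisc z -> box zeta rho z -> N (G1 k z) <= B) ->
  polydisc z -> box zeta rho z ->
  N (G z - G zeta) <= n%:R * (2 * B * (4 * rho)).
Proof.
move=> B0 rho0 Gc G1P G1B zp zb; apply/ler_addgt0Pr => e e0.
have [r r0 rP] := Gc e e0.
have m0 : 0 < Num.min r rho by rewrite lt_min r0 rho0.
have [w wp wb] := box_polydisc_ex zetaT m0.
have wr : box zeta r w by apply: boxW wb; rewrite ge_min lexx.
have {}wb : box zeta rho w by apply: boxW wb; rewrite ge_min lexx orbT.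
rewrite -(subrKA (G w)); apply: le_trans (cnorm1D _ _) _.
apply: lerD; last by apply: ltW; exact: rP.
apply: (polydisc_box_lipschitz G1P G1B) => // j.
rewrite -(subrKA (zeta 0 j)); apply: le_trans (cnorm1D _ _) _.
by rewrite (cnorm1_sub (zeta 0 j)); have := box_N j wb; have := box_N j zb; lra.
Qed.

Lemma is_real_partial_sub_linear (F : Cn -> R[i]) (z : Cn) (l : R[i])
    (a : 'I_n -> R[i]) (j : 'I_n) (b : bool) :
  is_real_partial (j, b) F z l ->
  is_real_partial (j, b) (fun w => F w - \sum_i a i * (w 0 i - zeta 0 i)) z
    (l - (if b then 'i%C else 1) * a j).
Proof.
move=> /is_real_partialP H; apply/is_real_partialP => e e0.
have := H e e0; rewrite !near_withinE.
apply: filterS => h Hh h0; apply: le_lt_trans (Hh h0).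
have hn0 : h%:C != 0 :> R[i] by apply: contra_neq h0 => h0; exact: complexI.
rewrite le_eqVlt; apply/orP; left; apply/eqP; congr (N _).
set c := (if b then _ else _).
have -> : \sum_i a i * ((z + h%:C *: coord_dir R (j, b)) 0 i - zeta 0 i) =
    \sum_i a i * (z 0 i - zeta 0 i) + h%:C * (c * a j).
  rewrite [X in _ = _ + X](_ : _ =
      \sum_i (if i == j then h%:C * (c * a i) else 0)); last first.
    by rewrite -big_mkcond big_pred1_eq.
  rewrite -big_split; apply: eq_bigr => i _; rewrite !mxE /= -/c.
  case: eqVneq => _; rewrite ?mulr1 ?mulr0; ring.
by field.
Qed.

Variables (F : Cn -> R[i]) (F1 : 'I_n * bool -> Cn -> R[i])
  (F2 : 'I_n * bool -> 'I_n * bool -> Cn -> R[i]).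
Hypothesis Fc : {within @closed_polydisc R n, continuous F}.
Hypothesis F1c : forall k, {within @closed_polydisc R n, continuous (F1 k)}.
Hypothesis F2c : forall k l,
  {within @closed_polydisc R n, continuous (F2 k l)}.
Hypothesis F1P : forall k z, polydisc z -> is_real_partial k F z (F1 k z).
Hypothesis F2P : forall k l z, polydisc z ->
  is_real_partial l (F1 k) z (F2 k l z).
Variable f : Cn -> R[i].
Hypothesis f_hol : holomorphic_on (@polydisc R n) f.
Hypothesis Ff : forall z, polydisc z -> F z = f z.

(** Holds in the interior by holomorphy and passes to [zeta] by continuity of the first derivatives.
    One complex coefficient per variable then describes the linear part. *)
Lemma cauchy_riemann_at j : F1 (j, true) zeta = 'i%C * F1 (j, false) zeta.
Proof.
have zc := torus_closed zetaT.
have Ni : N ('i%C : R[i]) = 1 by rewrite /cnorm1 /= normr0 normr1 add0r.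
apply/eqP; rewrite -subr_eq0; apply/eqP; apply: cnorm1_eq0 => e e0.
have e20 : 0 < e / 2 by rewrite divr_gt0.
have [r r0 rP] := within_box (@F1c (j, true)) zc e20.
have [s s0 sP] := within_box (@F1c (j, false)) zc e20.
have m0 : 0 < Num.min r s by rewrite lt_min r0 s0.
have [w wp wb] := box_polydisc_ex zetaT m0.
have wr : box zeta r w by apply: boxW wb; rewrite ge_min lexx.
have ws : box zeta s w by apply: boxW wb; rewrite ge_min lexx orbT.
have CR : F1 (j, true) w = 'i%C * F1 (j, false) w.
  rewrite (is_real_partial_unique (@F1P (j, true) w wp)
    (@holomorphic_partial _ _ f F w j true (f_hol wp) wp Ff)).
  rewrite (is_real_partial_unique (@F1P (j, false) w wp)
    (@holomorphic_partial _ _ f F w j false (f_hol wp) wp Ff)).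
  by rewrite mul1r.
rewrite -(subrKA (F1 (j, true) w)); apply: le_trans (cnorm1D _ _) _.
rewrite (cnorm1_sub (F1 (j, true) zeta)).
have -> : F1 (j, true) w - 'i%C * F1 (j, false) zeta =
  'i%C * (F1 (j, false) w - F1 (j, false) zeta) by rewrite mulrBr CR.
have := cnorm1M 'i%C (F1 (j, false) w - F1 (j, false) zeta).
rewrite Ni mul1r => h; rewrite (splitr e); apply: lerD.
  exact: ltW (rP w wp wr).
exact: le_trans h (ltW (sP w wp ws)).
Qed.

Lemma taylor_at : exists r K : R, [/\ 0 < r, 0 <= K & forall rho z,
  0 < rho <= r -> polydisc z -> box zeta rho z ->
  N (F z - F zeta - \sum_j F1 (j, false) zeta * (z 0 j - zeta 0 j)) <=
    K * rho ^+ 2].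
Proof.
have zc := torus_closed zetaT.
have [r r0 rP] : exists2 r : R, 0 < r &
    forall (kl : ('I_n * bool) * ('I_n * bool)) z, polydisc z ->
      box zeta r z -> N (F2 kl.1 kl.2 z - F2 kl.1 kl.2 zeta) < 1.
  apply: (@common_radius R _ (fun kl r => forall z, polydisc z ->
      box zeta r z -> N (F2 kl.1 kl.2 z - F2 kl.1 kl.2 zeta) < 1)).
    by move=> i r s sr rP z zp zb; apply: rP => //; exact: boxW zb.
  by move=> kl; exact: (@within_box _ _ (F2 kl.1 kl.2) zeta 1 (@F2c kl.1 kl.2)).
pose M := 1 + \sum_kl N (F2 kl.1 kl.2 zeta).
have M0 : 0 <= M by rewrite addr_ge0// sumr_ge0// => ? _; exact: cnorm1_ge0.
have F2M k l z : polydisc z -> box zeta r z -> N (F2 k l z) <= M.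
  move=> zp zb; rewrite -(subrK (F2 k l zeta) (F2 k l z)).
  apply: le_trans (cnorm1D _ _) _; apply: lerD.
    by apply: ltW; exact: (rP (k, l)).
  rewrite (bigD1 (k, l))//= lerDl sumr_ge0// => ? _; exact: cnorm1_ge0.
pose L := n%:R * (2 * M * 4).
have L0 : 0 <= L by rewrite !mulr_ge0.
have F1L k z rho : 0 < rho <= r -> polydisc z -> box zeta rho z ->
    N (F1 k z - F1 k zeta) <= L * rho.
  move=> /andP[rho0 rhor] zp zb.
  have -> : L * rho = n%:R * (2 * M * (4 * rho)) by rewrite /L; ring.
  apply: (@lipschitz_at (F1 k) (F2 k) M rho z M0 rho0 _ _ _ zp zb).
  - by move=> e e0; exact: (@within_box _ _ (F1 k) zeta e (@F1c k)).
  - by move=> l w wp; exact: (@F2P k l w wp).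
  - by move=> l w wp wb; apply: (F2M k l w wp); exact: boxW wb.
exists r, (n%:R * (2 * L * 4)); split => //; first by rewrite !mulr_ge0.
move=> rho z rho0r zp zb; have /andP[rho0 rhor] := rho0r.
pose a j := F1 (j, false) zeta.
(* The partial derivatives of [G] are those of [F] minus their values at [zeta], hence at most L rho
   on the box; a second use of the Lipschitz bound yields rho^2. *)
pose G w := F w - \sum_j a j * (w 0 j - zeta 0 j).
have Gzeta : G zeta = F zeta.
  by rewrite /G big1 ?subr0// => j _; rewrite subrr mulr0.
have -> : F z - F zeta - \sum_j F1 (j, false) zeta * (z 0 j - zeta 0 j) =
    G z - G zeta by rewrite Gzeta /G addrAC.
have -> : n%:R * (2 * L * 4) * rho ^+ 2 = n%:R * (2 * (L * rho) * (4 * rho)).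
  by ring.
have Lrho0 : 0 <= L * rho by apply: mulr_ge0 => //; exact: ltW.
apply: (@lipschitz_at G (fun k w => F1 k w - F1 k zeta) (L * rho) rho z
  Lrho0 rho0 _ _ _ zp zb).
- move=> e e0; have e20 : 0 < e / 2 by rewrite divr_gt0.
  have [s s0 sP] := within_box Fc zc e20.
  pose A := \sum_j N (a j).
  have A0 : 0 <= A by rewrite sumr_ge0// => ? _; exact: cnorm1_ge0.
  have A1 : 0 < 4 * (A + 1) by lra.
  exists (Num.min s (e / (4 * (A + 1)))).
    by rewrite lt_min s0 divr_gt0.
  move=> w wp wb; have ws : box zeta s w by apply: boxW wb; rewrite ge_min lexx.
  have {}wb : box zeta (e / (4 * (A + 1))) w.
    by apply: boxW wb; rewrite ge_min lexx orbT.
  rewrite Gzeta /G addrAC; apply: le_lt_trans (cnorm1B _ _) _.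
  have S : N (\sum_j a j * (w 0 j - zeta 0 j)) <= A * (2 * (e / (4 * (A + 1)))).
    apply: le_trans (cnorm1_sum _) _; rewrite mulr_suml; apply: ler_sum => j _.
    apply: le_trans (cnorm1M _ _) _; apply: ler_wpM2l; first exact: cnorm1_ge0.
    exact: box_N.
  have : A * (2 * (e / (4 * (A + 1)))) <= e / 2.
    rewrite (_ : A * _ = (e / 2) * (A / (A + 1))); last by field; lra.
    by rewrite ler_piMr ?ltW// ltr_pdivrMr; lra.
  by have := sP w wp ws; lra.
- move=> [j b] w wp.
  have -> : F1 (j, b) zeta = (if b then 'i%C else 1) * a j.
    by case: b; rewrite ?mul1r// cauchy_riemann_at.
  exact: is_real_partial_sub_linear (@F1P (j, b) w wp).
- by move=> k w wp wb; exact: (F1L k w rho rho0r wp wb).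
Qed.

End Taylor.

(** * Boundary points of modulus one *)

Lemma le0_of_small (R : realType) (x C t0 : R) : 0 < t0 ->
  (forall t, 0 < t < t0 -> x <= t * C) -> x <= 0.
Proof.
move=> t00 H; apply/ler_addgt0Pr => e e0; rewrite add0r.
have C1 : 0 < `|C| + 1 by rewrite ltr_wpDl.
pose t := Num.min (t0 / 2) (e / (`|C| + 1)).
have tpos : 0 < t by rewrite lt_min !divr_gt0.
have tt0 : t < t0 by rewrite gt_min; apply/orP; left; lra.
have te : t * (`|C| + 1) <= e by rewrite -ler_pdivlMr// ge_min lexx orbT.
apply: le_trans (H t _) _; first by rewrite tpos.
apply: le_trans te; apply: ler_wpM2l; first exact: ltW.
by have := ler_norm C; lra.
Qed.

Section BoundaryExpansion.
Variables (R : realType) (n : nat).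
Local Notation Cn := 'rV[R[i]]_n.
Variables (zeta : Cn) (eta : R[i]).
Hypotheses (zetaT : torus zeta) (etaT : `|eta| = 1).

Definition boundary_chart (u v : 'I_n -> R) : Cn :=
  \row_j (zeta 0 j * Complex (1 - u j) (- v j)).

Lemma unit_cnorm1 (z : R[i]) : `|z| = 1 -> N z <= 2.
Proof.
move=> /normc_eq1; case: z => a b /=; rewrite /cnorm1 /=.
rewrite -(real_normK (num_real a)) -(real_normK (num_real b)).
have := sqr_ge0 (`|a| - 1); have := sqr_ge0 (`|b| - 1); rewrite !expr2; nra.
Qed.

Lemma polydisc_chart u v :
  (forall j, (1 - u j) ^+ 2 + v j ^+ 2 < 1) -> polydisc (boundary_chart u v).
Proof.
by move=> uv j; rewrite mxE normrM zetaT mul1r normc_lt1 /= sqrrN.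
Qed.

(** The divisor 4 absorbs two losses: N (u + i v) <= rho / 2 and N zeta_j <= 2. *)
Lemma box_chart u v rho :
  (forall j, 0 <= u j <= rho / 4 /\ `|v j| <= rho / 4) ->
  box zeta rho (boundary_chart u v).
Proof.
move=> uv j; have [/andP[u0 u1] v1] := uv j.
have : N (boundary_chart u v 0 j - zeta 0 j) <= rho.
  rewrite mxE (_ : _ - _ = zeta 0 j * Complex (- u j) (- v j)); last first.
    rewrite -[X in _ - X]mulr1 -mulrBr; congr (_ * _).
    by apply/eqP; rewrite eq_complex /= subr0 eqxx andbT; apply/eqP; ring.
  apply: le_trans (cnorm1M _ _) _.
  have := unit_cnorm1 (zetaT j).
  have : N (Complex (- u j) (- v j)) <= rho / 2.
    by rewrite /cnorm1 /= !normrN (ger0_norm u0); lra.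
  have := cnorm1_ge0 (zeta 0 j).
  have := cnorm1_ge0 (Complex (- u j) (- v j)); nra.
by rewrite /cnorm1; have := normr_ge0 (Re (boundary_chart u v 0 j - zeta 0 j));
  have := normr_ge0 (Im (boundary_chart u v 0 j - zeta 0 j)); lra.
Qed.

Variables (F : Cn -> R[i]) (a : 'I_n -> R[i]) (r K : R).
Hypothesis r0 : 0 < r.
Hypothesis F_zeta : F zeta = eta.
Hypothesis F_disc : forall z, polydisc z -> `|F z| < 1.
Hypothesis F_taylor : forall rho z, 0 < rho <= r -> polydisc z ->
  box zeta rho z ->
  N (F z - F zeta - \sum_j a j * (z 0 j - zeta 0 j)) <= K * rho ^+ 2.

(** The alpha_j of the expansion. Multiplication by zeta_j takes the derivative in the radial
    direction, and the conjugate of [eta] is its inverse. *)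
Definition normal_coef j := eta^*%C * (a j * zeta 0 j).

Lemma eta_conj : eta * eta^*%C = 1.
Proof. by rewrite -sqr_normc etaT expr1n. Qed.

Lemma expansion_chart u v rho : 0 < rho <= r ->
  (forall j, (1 - u j) ^+ 2 + v j ^+ 2 < 1) ->
  (forall j, 0 <= u j <= rho / 4 /\ `|v j| <= rho / 4) ->
  N (F (boundary_chart u v) -
     eta * (1 - \sum_j normal_coef j * Complex (u j) (v j))) <= K * rho ^+ 2.
Proof.
move=> rhor uv1 uv2.
have := F_taylor rhor (polydisc_chart uv1) (box_chart uv2).
set S := \sum_j a j * _.
have -> : S = - (eta * \sum_j normal_coef j * Complex (u j) (v j)).
  rewrite mulr_sumr -sumrN; apply: eq_bigr => j _.
  have -> : boundary_chart u v 0 j - zeta 0 j =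
      zeta 0 j * - Complex (u j) (v j).
    rewrite mxE -[X in _ - X]mulr1 -mulrBr; congr (_ * _).
    by apply/eqP; rewrite eq_complex /= subr0 eqxx andbT; apply/eqP; ring.
  by rewrite /normal_coef !mulrN; congr (- _); rewrite !mulrA eta_conj mul1r.
by congr (N _ <= _); rewrite F_zeta; ring.
Qed.

Lemma ReM (z w : R[i]) : Re (z * w) = Re z * Re w - Im z * Im w.
Proof. by case: z w => [x y] [x' y']. Qed.

Lemma Im_normal_coef_le (j : 'I_n) (e : R) : `|e| = 1 ->
  e * Im (normal_coef j) <= 0.
Proof.
move=> e1.
have e2 : e ^+ 2 = 1 by rewrite -(real_normK (num_real e)) e1 expr1n.
pose S := \sum_k Re (normal_coef k).
pose t0 := Num.min (1 / 2) (r / 8).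
have t00 : 0 < t0 by rewrite lt_min !divr_gt0.
(* Re (F / eta) < 1 makes the term of order t at most t^2 (S + 128 K): the Taylor error is K rho^2
   with rho = 8 t, doubled by the bound 2 on the norm of the conjugate of [eta]. *)
apply: (@le0_of_small _ _ (S + 128 * K) t0) => // t /andP[t_gt0 t_lt].
have t2 : t < 1 / 2 by apply: lt_le_trans t_lt _; rewrite ge_min lexx.
have tr : t < r / 8 by apply: lt_le_trans t_lt _; rewrite ge_min lexx orbT.
pose u (_ : 'I_n) := t ^+ 2.
pose v (k : 'I_n) := if k == j then e * t else 0.
have uv1 k : (1 - u k) ^+ 2 + v k ^+ 2 < 1.
  apply: (@le_lt_trans _ _ ((1 - t ^+ 2) ^+ 2 + t ^+ 2)).
    rewrite lerD2l /v; case: ifP => _; last by rewrite expr0n sqr_ge0.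
    by rewrite exprMn e2 mul1r.
  have : 0 < t ^+ 2 < 1 by rewrite expr2; nra.
  move: (t ^+ 2) => q q01; nra.
have uv2 k : 0 <= u k <= (8 * t) / 4 /\ `|v k| <= (8 * t) / 4.
  split; first by rewrite /u sqr_ge0 expr2; nra.
  rewrite /v; case: ifP => _; last by rewrite normr0; lra.
  by rewrite normrM e1 mul1r gtr0_norm//; lra.
have rhor : 0 < 8 * t <= r by lra.
have E := expansion_chart rhor uv1 uv2.
have D := F_disc (polydisc_chart uv1).
set Fz := F _ in E D.
set T := \sum_k _ in E.
have ReT : Re T = t ^+ 2 * S - e * t * Im (normal_coef j).
  rewrite /T raddf_sum /=.
  under eq_bigr do rewrite ReM /=.
  rewrite big_split /= /S mulr_sumr; congr (_ + _).
    by apply: eq_bigr => k _; rewrite mulrC.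
  rewrite (bigD1 j) //= /v eqxx big1 ?addr0; last first.
    by move=> k /negbTE ->; rewrite mulr0 oppr0.
  by rewrite mulrC.
have R1 : Re (eta^*%C * Fz) < 1.
  rewrite -ltcR; apply: le_lt_trans (_ : _ <= `|eta^*%C * Fz|) _.
    by apply: le_trans (Re_le_normc _); rewrite lecR ler_norm.
  by rewrite normrM normcJ etaT mul1r.
have R2 : `|Re (eta^*%C * Fz - (1 - T))| <= 2 * (K * (8 * t) ^+ 2).
  apply: (@le_trans _ _ (N (eta^*%C * (Fz - eta * (1 - T))))).
    rewrite mulrBr mulrA [_ * eta]mulrC eta_conj mul1r.
    by rewrite /cnorm1 lerDl.
  apply: le_trans (cnorm1M _ _) _.
  apply: ler_pM => //; try exact: cnorm1_ge0.
  by apply: unit_cnorm1; rewrite normcJ.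
have ReB (x y : R[i]) : Re (x - y) = Re x - Re y by case: x y => [? ?] [? ?].
move: R2; rewrite !ReB ReT /= ler_norml => /andP[R2 _].
have : t * (e * Im (normal_coef j)) <= t * (t * (S + 128 * K)).
  by move: R1 R2; rewrite /=; lra.
by rewrite ler_pM2l.
Qed.

Lemma Im_normal_coef j : Im (normal_coef j) = 0.
Proof.
have := @Im_normal_coef_le j 1 (normr1 _).
have := @Im_normal_coef_le j (- 1) (normrN1 _).
by rewrite mul1r mulN1r; lra.
Qed.

End BoundaryExpansion.

(** * From the slab to the sublevel set *)

(** Unites the two cases at offset 0: when all weights vanish, s^(3n) dominates s^(3n+1) because s <
    1. *)
Lemma slab_ge0 (R : realType) n (p q be : 'I_n -> R) (k : R) : 0 < k ->
  (forall j, p j ^+ 2 + q j ^+ 2 = 1) ->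
  exists2 c, 0 < c & forall s, 0 < s < 1 ->
    ((c * s ^+ (3 * n + 1))%:E <=
       power_measure (@lebesgue_measure R \x @lebesgue_measure R)%E
         (slab p q be k s 0))%E.
Proof.
move=> k0 pq; have [be_n0|be0] := pselect (exists j, be j != 0).
  have [c [e [c0 e0 H]]] := slab_ge k0 pq be_n0.
  exists c => // s /[dup] s01 /andP[s0 _]; apply: H => //.
  by rewrite normr0 mulr_ge0// ltW.
have {}be0 j : be j = 0.
  by apply: contrapT => /eqP bj; apply: be0; exists j.
have [c c0 H] := slab_free_ge k0 pq be0.
exists c => // s /[dup] s01 /andP[s0 s1]; apply: le_trans (H s 0 s01 _).
  rewrite lee_fin ler_pM2l// exprD expr1 ler_piMr//; last exact: ltW.
  by rewrite exprn_ge0// ltW.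
by rewrite normr0 exprn_ge0// ltW.
Qed.

(** As zeta_j has modulus one, 1 - u_j - i v_j is the conjugate of zeta_j times z_j. *)
Lemma point_of_coords_chart (R : realType) n (zeta : 'rV[R[i]]_n)
    (t : n.-tuple (R * R)) : torus zeta ->
  point_of_coords t = boundary_chart zeta
    (fun j => 1 - (Re (zeta 0 j) * (tnth t j).1 + Im (zeta 0 j) * (tnth t j).2))
    (fun j => Im (zeta 0 j) * (tnth t j).1 - Re (zeta 0 j) * (tnth t j).2).
Proof.
move=> zetaT; apply/rowP => j; rewrite !mxE.
have := normc_eq1 (zetaT j).
case: (zeta 0 j) => p q /= pq; case: (tnth t j) => x y /=.
apply/eqP; rewrite eq_complex /=; apply/andP; split; apply/eqP.
- by rewrite -[LHS]mul1r -pq; ring.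
- by rewrite -[LHS]mul1r -pq; ring.
Qed.

Lemma power_sqrt (R : realType) (delta : R) (m : nat) : 0 <= delta ->
  delta `^ (m%:R / 2) = Num.sqrt delta ^+ m.
Proof.
by move=> d0; rewrite mulrC powRrM powR12_sqrt// powR_mulrn// sqrtr_ge0.
Qed.

(** The weights 8 alpha_j give |sum_j alpha_j v_j| <= s^2 / 8. The total is s^2 / 4 for the Taylor
    error plus 2 (s^2 / 8 + s^2 / 8) for eta T, the factor 2 bounding N eta. *)
Lemma slab_sub (R : realType) n (zeta : 'rV[R[i]]_n) (eta : R[i])
    (F : 'rV[R[i]]_n -> R[i]) (a : 'I_n -> R[i]) (r K : R) :
  torus zeta -> `|eta| = 1 -> 0 < r -> 0 <= K -> F zeta = eta ->
  (forall z, polydisc z -> `|F z| < 1) ->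
  (forall rho z, 0 < rho <= r -> polydisc z -> box zeta rho z ->
    N (F z - F zeta - \sum_j a j * (z 0 j - zeta 0 j)) <= K * rho ^+ 2) ->
  exists2 k, 0 < k & forall s, 0 < s < 1 ->
    slab (fun j => Re (zeta 0 j)) (fun j => Im (zeta 0 j))
      (fun j => 8 * Re (normal_coef zeta eta a j)) k s 0 `<=`
    [set t | polydisc (point_of_coords t) /\
             N (F (point_of_coords t) - eta) <= s ^+ 2].
Proof.
move=> zetaT etaT r0 K0 F_zeta F_disc F_taylor.
pose al j := Re (normal_coef zeta eta a j).
pose A := \sum_j `|al j|.
have A0 : 0 <= A by rewrite sumr_ge0.
(* The four bounds on k serve, in order: membership in the polydisc, rho = 4 k s <= r, Taylor error
   at most s^2 / 4, and |sum_j alpha_j u_j| <= s^2 / 8. *)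
pose k := Num.min (Num.min 1 (r / 4))
  (Num.min (1 / (64 * (K + 1))) (1 / (8 * (A + 1)))).
have K1 : 0 < 64 * (K + 1) by lra.
have A1 : 0 < 8 * (A + 1) by lra.
have k0 : 0 < k by rewrite !lt_min ltr01 !divr_gt0.
have /andP[/andP[k1 kr] /andP[kK kA]] :
    ((k <= 1) && (k <= r / 4)) &&
    ((k <= 1 / (64 * (K + 1))) && (k <= 1 / (8 * (A + 1)))).
  by rewrite -!le_min.
rewrite ler_pdivlMr// in kK; rewrite ler_pdivlMr// in kA.
exists k => // s s01 t [uv tau_le]; have /andP[s0 s1] := s01.
rewrite /= (point_of_coords_chart t zetaT).
set u := fun j : 'I_n => 1 - _; set v := fun j : 'I_n => _ - _.
have {}uv j : k * s ^+ 2 / 2 < u j < k * s ^+ 2 /\ `|v j| < k / 2 * s.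
  exact: uv.
have s2s : s ^+ 2 <= s by rewrite expr2; nra.
have s20 : 0 < s ^+ 2 by rewrite exprn_gt0.
(* k <= 1 gives v^2 <= k s^2 / 4 < u / 2, and u < 1. *)
have uv1 j : (1 - u j) ^+ 2 + v j ^+ 2 < 1.
  have [/andP[u1 u2] v1] := uv j.
  have v2 : v j ^+ 2 <= (k / 2 * s) ^+ 2.
    rewrite -(real_normK (num_real (v j))) !expr2.
    by apply: ler_pM => //; exact: ltW.
  have ks2 : k * s ^+ 2 <= 1 by rewrite -[leRHS]mulr1; apply: ler_pM => //; lra.
  have v3 : (k / 2 * s) ^+ 2 <= k * s ^+ 2 / 4.
    by rewrite exprMn !expr2; nra.
  have ks0 : 0 < k * s ^+ 2 by apply: mulr_gt0.
  move: u1 u2 v2 v3 ks2 ks0; move: (k * s ^+ 2) (u j) (v j ^+ 2) => w x y.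
  move=> *; nra.
have rho4 : (4 * k * s) / 4 = k * s by field.
have kss : k * s ^+ 2 <= k * s by rewrite ler_pM2l.
have ks0 : 0 < k * s by exact: mulr_gt0.
have uv2 j : 0 <= u j <= (4 * k * s) / 4 /\ `|v j| <= (4 * k * s) / 4.
  have [/andP[u1 u2] v1] := uv j; rewrite rho4.
  have ks2 : 0 < k * s ^+ 2 by apply: mulr_gt0.
  split; last by lra.
  by apply/andP; split; lra.
split; first exact: polydisc_chart.
have rhor : 0 < 4 * k * s <= r.
  by apply/andP; split; [lra|have : k * s <= k; nra].
have := expansion_chart zetaT etaT F_zeta F_taylor rhor uv1 uv2.
set Fz := F _; set T := \sum_j _ => E.
have TE : T = Complex (\sum_j al j * u j) (\sum_j al j * v j).
  apply/eqP; rewrite /T eq_complex /= !raddf_sum /=; apply/andP; split; apply/eqP.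
    apply: eq_bigr => j _.
    have := Im_normal_coef zetaT etaT r0 F_zeta F_disc F_taylor j.
    by rewrite /al; case: (normal_coef _ _ _ _) => x y /= ->; rewrite mul0r subr0.
  apply: eq_bigr => j _.
  have := Im_normal_coef zetaT etaT r0 F_zeta F_disc F_taylor j.
  by rewrite /al; case: (normal_coef _ _ _ _) => x y /= ->; rewrite mul0r addr0.
have Tu : `|\sum_j al j * u j| <= A * (k * s ^+ 2).
  apply: le_trans (ler_norm_sum _ _ _) _; rewrite mulr_suml.
  apply: ler_sum => j _; rewrite normrM; apply: ler_wpM2l => //.
  have [/andP[u1 u2] v1] := uv j; rewrite ger0_norm; first exact: ltW.
  by have [/andP[]] := uv2 j.
have Tv : `|\sum_j al j * v j| <= s ^+ 2 / 8.
  move: tau_le; rewrite add0r.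
  under eq_bigr do rewrite -mulrA.
  rewrite -mulr_sumr normrM (ger0_norm (ler0n _ 8)) => h.
  by rewrite ler_pdivlMr// mulrC.
have NT : N T <= A * (k * s ^+ 2) + s ^+ 2 / 8.
  by rewrite TE /cnorm1 /=; exact: lerD.
have -> : Fz - eta = (Fz - eta * (1 - T)) - eta * T by ring.
apply: le_trans (cnorm1B _ _) _.
have : N (eta * T) <= 2 * N T.
  apply: le_trans (cnorm1M _ _) _; apply: ler_wpM2r; first exact: cnorm1_ge0.
  exact: unit_cnorm1.
have Ak : A * (k * s ^+ 2) <= s ^+ 2 / 8.
  have : A * k <= 1 / 8 by lra.
  by nra.
have Kk : K * (4 * k * s) ^+ 2 <= s ^+ 2 / 4.
  have -> : K * (4 * k * s) ^+ 2 = (16 * (K * k) * k) * s ^+ 2 by ring.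
  have : 16 * (K * k) * k <= 1 / 4.
    have : 0 <= K * k by rewrite mulr_ge0// ltW.
    have : K * k <= 1 / 64 by lra.
    by nra.
  by nra.
lra.
Qed.

Theorem lemma3 (R : realType) (n : nat) (f F : 'rV[R[i]]_n -> R[i])
    (zeta : 'rV[R[i]]_n) (eta : R[i])
    (f_disc : forall z, polydisc z -> `|f z| < 1)
    (f_hol : holomorphic_on (@polydisc R n) f)
    (f_C2 : C2_extension f F)
    (zetaT : torus zeta) (etaT : `|eta| = 1) (f_zeta : F zeta = eta) :
  exists c : R, 0 < c /\
    forall delta : R, 0 < delta < 1 ->
      ((c * delta `^ ((3 * n + 1)%N%:R / 2))%:E <=
       vol [set z : 'rV[R[i]]_n |
              polydisc z /\ (`|f z - eta| <= delta%:C)%R])%E.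
Proof.
case: f_C2 => Ff [Fc [F1 [F2 [F1c F2c F1P F2P]]]].
have F_disc z : polydisc z -> `|F z| < 1.
  by move=> zp; rewrite Ff//; exact: f_disc.
have [r [K [r0 K0 F_taylor]]] :=
  taylor_at zetaT Fc F1c F2c F1P F2P f_hol Ff.
have [k k0 slabP] := slab_sub zetaT etaT r0 K0 f_zeta F_disc F_taylor.
have pq j : Re (zeta 0 j) ^+ 2 + Im (zeta 0 j) ^+ 2 = 1 by exact: normc_eq1.
have [c c0 Hc] := slab_ge0
  (fun j => 8 * Re (normal_coef zeta eta (fun j => F1 (j, false) zeta) j)) k0 pq.
exists (pi ^- n * c); split.
  by rewrite mulr_gt0// invr_gt0 exprn_gt0// pi_gt0.
move=> delta /andP[d0 d1]; rewrite power_sqrt; last exact: ltW.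
have s01 : 0 < Num.sqrt delta < 1.
  by rewrite sqrtr_gt0 d0 -[ltRHS]sqrtr1 ltr_sqrt.
rewrite -mulrA EFinM /vol; apply: lee_wpmul2l.
  by rewrite lee_fin invr_ge0 exprn_ge0// pi_ge0.
apply: le_trans (Hc _ s01) _; apply: le_power_measure => t /(slabP _ s01)/= [tp].
rewrite sqr_sqrtr; last exact: ltW.
move=> h; split => //; rewrite -Ff//.
by apply: le_trans (normc_le_cnorm1 _) _; rewrite lecR.
Qed.
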